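(* Let $r\ge1$ be an integer and $K,\lambda>0$. There is a constant $d\in\mathbb{N}$, depending only on $r$, $\lambda$ and $K$, such that the following holds. Let $S$ be a local energy with range $r$ and constants $K,\lambda$, and let $x,y\in\mathcal{M}$ be global minimizers whose domain of crossing $D$ is infinite. Then there exist monotone sequences $(k_n)_{n\in\mathbb{N}}$ and $(l_n)_{n\in\mathbb{N}}$ in $D$ with $|k_{n+1}-k_n|\le d$ and $|l_n-k_n|\le r$ such that for all $n$ $$x_{k_n}>y_{k_n},\qquad x_{l_n}<y_{l_n}\qquad\text{and}\qquad (x_{k_n}-y_{k_n})(y_{l_n}-x_{l_n})\ge 2^n .$$
   Context: Let $r\ge 1$ be an integer. A local energy with range $r$ and constants $K,\lambda>0$ is a function $S\in C^2(\mathbb{R}^{r+1})$ for which there are $f_1,\dots,f_r\in C^2(\mathbb{R}^2)$ with $S(\xi_1,\dots,\xi_{r+1})=\sum_{j=1}^r f_j(\xi_1,\xi_{j+1})$ such that for every $1\le j\le r$: (1) $f_j(\nu+1,\mu+1)=f_j(\nu,\mu)$; (2) $\|\partial_{i,k}f_j\|_{\sup}\le K/r$ for all $i,k\in\{1,2\}$; (3) $f_j(\nu,\mu)\to\infty$ as $|\nu-\mu|\to\infty$; (4) $\partial_1\partial_2 f_j(\nu,\mu)\le-\lambda<0$ for all $\nu,\mu\in\mathbb{R}$. For $x\in\mathbb{R}^{\mathbb{Z}}$ put $S_j(x):=S(x_j,\dots,x_{j+r})$. For integers $i_0\le i_1$ let $B=[i_0-r,i_1]\subset\mathbb{Z}$,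 with interior $\mathring{B}=[i_0,i_1]$, and $W_B(x):=\sum_{i\in B}S_i(x)$. A sequence $x\in\mathbb{R}^{\mathbb{Z}}$ is a global minimizer if $W_B(x)\le W_B(x+v)$ for every such $B$ and every $v\in\mathbb{R}^{\mathbb{Z}}$ supported in $\mathring{B}$; $\mathcal{M}$ is the set of global minimizers. Domain of crossing: for $x,y\in\mathbb{R}^{\mathbb{Z}}$ it is the interval $D\subset\mathbb{Z}$ (of the form $\varnothing$, $[j_0,j_1]$, $[j_0,\infty)$, $(-\infty,j_1]$ or $\mathbb{Z}$), minimal with respect to inclusion, such that on each connected component of $\mathbb{Z}\setminus D$ the sequences $x,y$ are weakly ordered (either $x_i\le y_i$ for all $i$ in the component or $x_i\ge y_i$ for all $i$ in the component); the ordering may differ on the two components. *)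

(* Defs.v *)
From mathcomp Require Import all_boot all_order all_algebra.
From mathcomp Require Import all_classical all_reals all_analysis.

Set Implicit Arguments.
Unset Strict Implicit.
Unset Printing Implicit Defensive.

Import Order.TTheory GRing.Theory Num.Theory.
Import numFieldNormedType.Exports.

Local Open Scope classical_set_scope.
Local Open Scope ring_scope.

Definition partial (R : realType) (n : nat) (i : 'I_n) (f : 'rV[R]_n -> R) :
    'rV[R]_n -> R :=
  fun a => 'D_(delta_mx 0 i) f a.

(* Existence is required separately from continuity: 'D_v f a is a total
   operator, with a junk value where the limit does not exist. *)
Definition partials_cont (R : realType) (n : nat) (f : 'rV[R]_n -> R) : Prop :=
  forall i : 'I_n,
    (forall a, derivable f a (delta_mx 0 i)) /\ continuous (partial i f).

Definition C2 (R : realType) (n : nat) (f : 'rV[R]_n -> R) : Prop :=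
  [/\ continuous f,
      partials_cont f
    & forall i : 'I_n, partials_cont (partial i f)].

Definition point2 (R : realType) (nu mu : R) : 'rV[R]_2 :=
  \row_(k < 2) (if k == 0 then nu else mu).

(* Coordinates are numbered from 0, so that partial 0 and partial 1 are the
   derivatives in the first and second variable of f, and for j : 'I_r the
   index lift 0 j (of value j + 1) is never the first one. *)
Definition local_energy (R : realType) (r : nat) (K lambda : R)
    (S : 'rV[R]_r.+1 -> R) : Prop :=
  C2 S /\
  exists f : 'I_r -> 'rV[R]_2 -> R,
    [/\ forall j, C2 (f j),
        forall xi : 'rV[R]_r.+1,
          S xi = \sum_(j < r) f j (point2 (xi 0 0) (xi 0 (lift 0 j)))
      & forall j : 'I_r,
        [/\ forall nu mu : R,
              f j (point2 (nu + 1) (mu + 1)) = f j (point2 nu mu),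
            forall (i k : 'I_2) (a : 'rV[R]_2),
              `|partial i (partial k (f j)) a| <= K / r%:R,
            forall A : R, exists M : R, forall nu mu : R,
              M <= `|nu - mu| -> A <= f j (point2 nu mu)
          & forall nu mu : R,
              partial 0 (partial 1 (f j)) (point2 nu mu) <= - lambda]].

Definition site_energy (R : realType) (r : nat) (S : 'rV[R]_r.+1 -> R)
    (x : int -> R) (j : int) : R :=
  S (\row_(k < r.+1) x (j + (k : nat)%:Z)).

(* Only used for finite B; a \sum_(i \in B) of infinite support would be 0. *)
Definition box_energy (R : realType) (r : nat) (S : 'rV[R]_r.+1 -> R)
    (B : set int) (x : int -> R) : R :=
  \sum_(i \in B) site_energy S x i.

Definition global_minimizer (R : realType) (r : nat) (S : 'rV[R]_r.+1 -> R)
    (x : int -> R) : Prop :=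
  forall (i0 i1 : int) (v : int -> R), i0 <= i1 ->
    (forall i, ~~ (i0 <= i <= i1) -> v i = 0) ->
    box_energy S [set i | i0 - r%:Z <= i <= i1] x
      <= box_energy S [set i | i0 - r%:Z <= i <= i1] (fun i => x i + v i).

(* C is a connected component of A: a maximal nonempty interval inside A. *)
Definition int_component (A C : set int) : Prop :=
  [/\ C !=set0, is_interval C, C `<=` A
    & forall C' : set int,
        is_interval C' -> C' `<=` A -> C `<=` C' -> C' = C].

Definition weakly_ordered_on (R : realType) (C : set int) (x y : int -> R) :
    Prop :=
  (forall i, C i -> x i <= y i) \/ (forall i, C i -> y i <= x i).

Definition ordered_outside (R : realType) (x y : int -> R) (D : set int) :
    Prop :=
  forall C, int_component (~` D) C -> weakly_ordered_on C x y.

(* "Minimal" is minimal for inclusion rather than least. A finite crossing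
   domain need not be unique (if x - y has signs ..., +, +, -, -, ... then
   each of the two sites at the sign change is one); an infinite one is. *)
Definition crossing_domain (R : realType) (x y : int -> R) (D : set int) :
    Prop :=
  [/\ is_interval D, ordered_outside x y D
    & forall D' : set int,
        is_interval D' -> ordered_outside x y D' -> D' `<=` D -> D' = D].

Definition monotone_int (u : nat -> int) : Prop :=
  (forall m n, (m <= n)%N -> u m <= u n) \/
  (forall m n, (m <= n)%N -> u n <= u m).

(* Main.v *)
Require Import Defs.
From mathcomp Require Import all_boot all_order all_algebra.
From mathcomp Require Import all_classical all_reals all_analysis.
From mathcomp Require Import zify ring lra.

Set Implicit Arguments.
Unset Strict Implicit.
Unset Printing Implicit Defensive.

Import Order.TTheory GRing.Theory Num.Theory.
Import numFieldNormedType.Exports.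

Local Open Scope classical_set_scope.
Local Open Scope ring_scope.

(** Put u = x - y.  Exchanging x and y on a finite set A of sites produces two
competitors, so the minimality of x and y says that the exchange costs energy.
By the twist condition, a pair of sites i, k separated by A costs
c u_i u_k with c between lam and kap = K / r, hence
    0 <= sum of c_ik u_i u_k over i in A, k outside A, |i - k| <= r
([minimizers_cut_ineq]).  Nearly everything is drawn from this cut inequality.

Let E(a, b) be the sum of u_i^+ u_k^- over the pairs in [a, b] at distance at
most r.  With A the set of the sites of [a, b] where u is positive, the cut
inequality bounds E(a, b) by the products u_i u_k of positive values at pairs
that straddle one of the two ends of [a, b]; with the negative sites it gives
the same bound by products of negative values ([crossing_le]).  Where both a
positive and a negative pair straddle the same point, the four sites contain a
crossing pair whose product is as large ([straddle_pair]).

Suppose that E(0, b) is unbounded in b.  The end a = 0 contributes a fixed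
amount, so for large b pairs of both signs with products of order E(0, b)
straddle b + 1; they yield a crossing pair of that size near b.  So E grows by
a fixed factor every [doubling] steps, and the crossing pairs are the required
k_n, l_n ([unbounded_growing]).  The case of E(a, 0) is its reflection.

It remains to see that E is unbounded on one side if u changes sign
arbitrarily far on one side, say on the right ([unbounded_left_or_right]).  If
E were bounded on both sides, the products of crossing pairs would tend to 0 at
both ends, while E itself is bounded below on large intervals.  A positive pair
of definite size cannot straddle every point far to the right: near a negative
site, the cut inequality for a single site would produce a negative value of
definite size next to a positive one ([no_eventual_straddle]).  The same holds
for negative pairs, so the left end of every large interval is straddled by
pairs of both signs and definite size, hence by crossing pairs of definite
size: a contradiction.  This uses that some crossing pair exists at all, which
the cut inequality does not give, since u might change sign across a run of r
zeros; there, a first order change at such a zero after the exchange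
contradicts minimality ([sign_change_crossing]).

Finally, minimality of the crossing domain D says that u changes sign beyond
any point in a direction in which D is unbounded
([crossing_domain_sign_change]), and the ordering outside D excludes growth in
a direction in which D is bounded ([unbounded_right_grow]). *)

(** * Finite sums over integer intervals *)

Definition irange (a b : int) : seq int :=
  if a <= b then [seq a + n%:Z | n <- iota 0 `|b - a|.+1] else [::].

Lemma mem_irange a b i : (i \in irange a b) = (a <= i <= b).
Proof.
rewrite /irange; case: ifPn => hab; last by rewrite in_nil; lia.
apply/mapP/idP => [[n]|hi]; first by rewrite mem_iota => hn ->; lia.
by exists `|i - a|%N; rewrite ?mem_iota; lia.
Qed.

Lemma uniq_irange a b : uniq (irange a b).
Proof.
rewrite /irange; case: ifP => // _.
by rewrite map_inj_uniq ?iota_uniq// => m n /addrI [].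
Qed.

Lemma size_irange (a b : int) (n : nat) :
  b - a < n%:Z -> (size (irange a b) <= n)%N.
Proof.
by rewrite /irange; case: ifP => // hab hn; rewrite size_map size_iota; lia.
Qed.

Lemma perm_irange_opp a b : perm_eq (irange (- b) (- a)) (map -%R (irange a b)).
Proof.
apply: uniq_perm; rewrite ?(map_inj_uniq (@oppr_inj int)) ?uniq_irange// => i.
 apply/idP/mapP => [|[k + ->]]; rewrite !mem_irange => h; last by lia.
by exists (- i); rewrite ?opprK// mem_irange; lia.
Qed.

Lemma ler_sum_subset (R : numDomainType) (T : eqType) (s t : seq T)
    (P Q : pred T) (F : T -> R) :
  uniq s -> (forall i, i \in s -> P i -> (i \in t) && Q i) ->
  (forall i, 0 <= F i) ->
  \sum_(i <- s | P i) F i <= \sum_(i <- t | Q i) F i.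
Proof.
move=> us st F0; rewrite -[leLHS]big_filter -[leRHS]big_filter.
have {st} : {subset [seq i <- s | P i] <= [seq i <- t | Q i]}.
  by move=> i; rewrite !mem_filter => /andP[Pi /st/(_ Pi)/andP[-> ->]].
move: (filter_uniq P us); move: [seq i <- s | P i] [seq i <- t | Q i].
elim=> [|x s' IH] t' /=; first by rewrite big_nil sumr_ge0.
move=> /andP[xs us'] st.
rewrite big_cons (big_rem x (st _ (mem_head _ _)))/= lerD2l.
apply: IH => // y ys; apply: rem_mem; first by apply: contraNneq xs => <-.
by rewrite st ?inE ?ys ?orbT.
Qed.

(** * The cut inequality and crossing pairs *)

Section Crossings.
Variables (R : archiRealFieldType) (r : nat) (lam kap : R).
Hypotheses (lam0 : 0 < lam) (lamkap : lam <= kap).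

Let kap0 : 0 < kap. Proof. exact: lt_le_trans lamkap. Qed.

Implicit Types (u : int -> R) (a b i j k : int).

Definition window i : seq int := irange (i - r%:Z) (i + r%:Z).

(** The largest c * s for c in [lam, kap]: it bounds the cost of separating two
sites at which the product of the values of u is s. *)
Definition pair_cost (s : R) : R := if 0 <= s then kap * s else lam * s.

(** The sites of A are those at which the two configurations with difference u are
exchanged; only the pairs that A separates change the energy. *)
Definition cut_ineq u : Prop := forall A : seq int, uniq A ->
  0 <= \sum_(i <- A) \sum_(k <- window i | k \notin A) pair_cost (u i * u k).

Definition pos_part (t : R) : R := Num.max t 0.

Lemma pos_part_ge0 t : 0 <= pos_part t.
Proof. by rewrite /pos_part le_max lexx orbT. Qed.

Lemma pos_partE t : 0 <= t -> pos_part t = t.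
Proof. by move=> t0; apply/max_idPl. Qed.

Lemma pos_part0 t : t <= 0 -> pos_part t = 0.
Proof. by move=> t0; apply/max_idPr. Qed.

Definition crossing u a b : R :=
  \sum_(i <- irange a b) \sum_(k <- irange a b | `|i - k| <= r%:Z)
    pos_part (u i) * pos_part (- u k).

(** The bound concerns the positive values of u only; that for the negative
values is the same statement for - u. *)
Definition straddle_bound u a (mu : R) : Prop :=
  forall i k, i < a -> a <= k -> k - i <= r%:Z ->
    0 < u i -> 0 < u k -> u i * u k <= mu.

(** At most 2r sites of an interval are within r of its complement, and each has at
most 2r + 1 neighbours. *)
Definition nstraddle : R := (2 * r * (2 * r).+1)%:R.

(** The cut inequality for the set of positive sites of [a, b].  A separated pair
of opposite signs lowers the sum by at least lam times its product, and every
crossing pair of [a, b] is separated; a separated pair of positive values has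
one site outside [a, b], so it straddles an end. *)
Lemma crossing_le u a b mu : cut_ineq u -> 0 <= mu ->
  straddle_bound u a mu -> straddle_bound u (b + 1) mu ->
  lam * crossing u a b <= kap * nstraddle * mu.
Proof.
move=> cut mu0 ha hb.
pose A := [seq i <- irange a b | 0 < u i].
have uA : uniq A by rewrite filter_uniq ?uniq_irange.
(* The sites of [a, b] that have a neighbour outside [a, b]. *)
pose near i := (i < a + r%:Z) || (b - r%:Z < i).
have nearP i k : a <= i <= b -> ~~ (a <= k <= b) ->
    i - r%:Z <= k <= i + r%:Z -> near i by rewrite /near; clear; lia.
pose F i := \sum_(k <- irange a b | `|i - k| <= r%:Z)
  pos_part (u i) * pos_part (- u k).
pose C : R := kap * (2 * r).+1%:R * mu.
have C0 : 0 <= C by rewrite !mulr_ge0// ltW.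
have inner i : i \in irange a b -> 0 < u i ->
    \sum_(k <- window i | k \notin A) pair_cost (u i * u k) <=
    - lam * F i + (if near i then C else 0).
  move=> iab ui0.
  have step : \sum_(k <- window i | k \notin A) pair_cost (u i * u k) <=
      \sum_(k <- window i) (- lam *
          (if k \in irange a b then pos_part (u i) * pos_part (- u k) else 0)
        + (if near i then kap * mu else 0)).
    rewrite big_mkcond big_seq [leRHS]big_seq; apply: ler_sum => k.
    have kmu : 0 <= kap * mu by rewrite mulr_ge0// ltW.
    have nr0 : 0 <= (if near i then kap * mu else 0) by case: ifP.
    rewrite mem_irange /A mem_filter => kw; have [uk0|uk0] := ltP 0 (u k).
      rewrite (pos_part0 (t := - u k)) ?oppr_le0 ?(ltW uk0)//= mulr0.
      rewrite if_same mulr0 add0r.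
      case: ifPn => // kab; rewrite /pair_cost (mulr_ge0 (ltW ui0) (ltW uk0)).
      move: iab kab; rewrite !mem_irange => iab kab.
      rewrite (nearP _ _ iab kab kw) ler_pM2l//; have [ka|ka] := ltP k a.
        rewrite mulrC; apply: ha => //; move: ka kw iab; clear; lia.
      apply: hb => //; move: ka kab kw iab; clear; lia.
    rewrite /= (pos_partE (ltW ui0)) (pos_partE (t := - u k)) ?oppr_ge0//.
    have uu : u i * u k <= 0 by rewrite pmulr_rle0.
    have -> : pair_cost (u i * u k) = lam * (u i * u k).
      rewrite /pair_cost; case: ifP => // h.
      have -> : u i * u k = 0 by apply/eqP; rewrite eq_le uu h.
      by rewrite !mulr0.
    have luu : lam * (u i * u k) <= 0 by rewrite pmulr_rle0.
    case: (k \in irange a b).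
      by rewrite !mulrN mulNr opprK lerDl.
    by rewrite mulr0 add0r (le_trans luu).
  apply: (le_trans step); rewrite big_split /= -mulr_sumr -big_mkcond /=.
  apply: lerD.
    rewrite ler_nM2l ?oppr_lt0//; apply: ler_sum_subset; first exact: uniq_irange.
      by move=> k; rewrite !mem_irange; clear; lia.
    by move=> k; rewrite mulr_ge0// pos_part_ge0.
  case: ifP => _; last by rewrite big1.
  rewrite big_const_seq count_predT iter_addr_0 /C -[leLHS]mulr_natr.
  rewrite [leLHS]mulrAC.
  have : (size (window i) <= (2 * r).+1)%N by apply: size_irange; clear; lia.
  by rewrite -(ler_nat R) => h; rewrite ler_wpM2r// ler_wpM2l// ltW.
have := cut A uA; rewrite /A big_filter => h.
have {h} : 0 <= \sum_(i <- irange a b | 0 < u i)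
   (- lam * F i + (if near i then C else 0)).
  apply: (le_trans h); rewrite big_seq_cond [leRHS]big_seq_cond.
  by apply: ler_sum => i /andP[iab ui0]; apply: inner.
rewrite big_split /= -mulr_sumr.
have -> : \sum_(i <- irange a b | 0 < u i) F i = crossing u a b.
  rewrite big_mkcond; apply: eq_bigr => i _; case: ltP => // ui.
  by rewrite /F big1// => k _; rewrite (pos_part0 ui) mul0r.
suff : \sum_(i <- irange a b | 0 < u i) (if near i then C else 0) <=
  kap * nstraddle * mu by lra.
pose ends := irange a (a + r%:Z - 1) ++ irange (b - r%:Z + 1) b.
apply: (@le_trans _ _ (\sum_(i <- ends) C)).
  rewrite -big_mkcondr; apply: ler_sum_subset => //; first exact: uniq_irange.
  by move=> i; rewrite /ends mem_cat !mem_irange /near; clear; lia.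
rewrite big_const_seq count_predT iter_addr_0 /C /nstraddle -[leLHS]mulr_natr natrM.
have : (size ends <= 2 * r)%N.
  rewrite /ends size_cat mul2n -addnn; apply: leq_add; apply: size_irange; clear; lia.
rewrite -(ler_nat R) => h.
rewrite [leLHS]mulrAC ler_wpM2r// (mulrC (2 * r)%:R) mulrA ler_wpM2l//.
by rewrite mulr_ge0// ltW.
Qed.

Lemma cut_ineqN u : cut_ineq u -> cut_ineq (fun i => - u i).
Proof.
move=> cut A uA; rewrite (le_trans (cut A uA))//.
by apply: ler_sum => i _; apply: ler_sum => k _; rewrite mulrNN.
Qed.

Lemma cut_ineq_refl u : cut_ineq u -> cut_ineq (u \o -%R).
Proof.
move=> cut A uA; have := cut (map -%R A).
rewrite (map_inj_uniq (@oppr_inj int)) => /(_ uA).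
rewrite big_map => /le_trans; apply; apply: ler_sum => i _.
have -> : window (- i) = irange (- (i + r%:Z)) (- (i - r%:Z)).
  by rewrite /window; congr irange; clear; lia.
rewrite (perm_big _ (perm_irange_opp _ _)) big_map.
by under eq_bigl => k do rewrite (mem_map (@oppr_inj int)).
Qed.

Lemma crossingN u a b : crossing (fun i => - u i) a b = crossing u a b.
Proof.
rewrite /crossing (exchange_big_dep predT)//=; apply: eq_bigr => i _.
apply: eq_big => k; first by rewrite distrC.
by rewrite opprK mulrC.
Qed.

Lemma crossing_refl u a b : crossing (u \o -%R) a b = crossing u (- b) (- a).
Proof.
rewrite /crossing (perm_big _ (perm_irange_opp _ _)) big_map.
apply: eq_bigr => i _; rewrite (perm_big _ (perm_irange_opp _ _)) big_map.
by apply: eq_bigl => k; rewrite -opprD normrN.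
Qed.

Let term_ge0 u i k : 0 <= pos_part (u i) * pos_part (- u k).
Proof. by rewrite mulr_ge0 ?pos_part_ge0. Qed.

Lemma crossing_ge0 u a b : 0 <= crossing u a b.
Proof. by rewrite sumr_ge0// => i _; rewrite sumr_ge0. Qed.

(** The pairs with one site on each side of b are dropped, hence no equality. *)
Lemma crossing_superadd u a b b' : a <= b + 1 -> b <= b' ->
  crossing u a b + crossing u (b + 1) b' <= crossing u a b'.
Proof.
move=> ab bb'.
pose F i := \sum_(k <- irange a b' | `|i - k| <= r%:Z)
  pos_part (u i) * pos_part (- u k).
have F0 i : 0 <= F i by rewrite sumr_ge0.
apply: (@le_trans _ _ (\sum_(i <- irange a b ++ irange (b + 1) b') F i)).
  rewrite big_cat lerD//=; apply: ler_sum => i _;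
    apply: ler_sum_subset => //; rewrite ?uniq_irange// => k;
    rewrite !mem_irange => + ->; rewrite andbT; move: ab bb'; clear; lia.
apply: ler_sum_subset => //.
  rewrite cat_uniq !uniq_irange andbT /=; apply/hasPn => i /=.
  by rewrite !mem_irange; clear; lia.
by move=> i; rewrite mem_cat !mem_irange; move: ab bb'; clear; lia.
Qed.

Definition crossing_pair u p m (mu : R) : Prop :=
  [/\ `|p - m| <= r%:Z, 0 < u p, u m < 0 & mu <= u p * - u m].

Lemma crossing_ge_pair u a b p m mu : crossing_pair u p m mu ->
  a <= p <= b -> a <= m <= b -> mu <= crossing u a b.
Proof.
move=> [pm up um le_mu] hp hm; apply: (le_trans le_mu).
pose G i := \sum_(k <- [:: m] | `|i - k| <= r%:Z) pos_part (u i) * pos_part (- u k).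
apply: (@le_trans _ _ (\sum_(i <- [:: p]) G i)).
  rewrite big_seq1 /G big_mkcond big_seq1 pm (pos_partE (ltW up)) pos_partE//.
  by rewrite oppr_ge0 ltW.
apply: (@le_trans _ _ (\sum_(i <- irange a b) G i)).
  apply: ler_sum_subset => //.
    by move=> i; rewrite inE mem_irange => /eqP ->; rewrite hp.
  by move=> i; rewrite sumr_ge0.
apply: ler_sum => i _; apply: ler_sum_subset => // k.
by rewrite inE mem_irange => /eqP -> ->; rewrite hm.
Qed.

Lemma crossing_le_right u a b b' : b <= b' -> crossing u a b <= crossing u a b'.
Proof.
move=> bb'; have [ab|ba] := leP a (b + 1).
  rewrite (le_trans _ (crossing_superadd u ab bb'))// lerDl.
  exact: crossing_ge0.
rewrite {1}/crossing {1}/irange.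
have -> : (a <= b) = false by move: ba; clear; lia.
by rewrite big_nil crossing_ge0.
Qed.

Lemma crossing_le_left u a a' b : a' <= a -> crossing u a b <= crossing u a' b.
Proof.
move=> aa; have := @crossing_le_right (u \o -%R) (- b) (- a) (- a').
by rewrite !crossing_refl !opprK lerN2; apply.
Qed.

Definition straddle_ge u a (mu : R) : Prop :=
  exists i k, [/\ i < a, a <= k, k - i <= r%:Z &
    [/\ 0 < u i, 0 < u k & mu <= u i * u k]].

Hypothesis r0 : (0 < r)%N.

Lemma nstraddle_gt0 : 0 < nstraddle.
Proof. by rewrite ltr0n muln_gt0 muln_gt0 r0. Qed.

(** Half of the constant in [crossing_le], which leaves room for a strict
inequality when that lemma is contradicted. *)
Definition rate : R := lam / (2 * (kap * nstraddle)).

Lemma rate_gt0 : 0 < rate.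
Proof. by rewrite divr_gt0 ?mulr_gt0 ?nstraddle_gt0. Qed.

Lemma straddle_or u a b : cut_ineq u -> 0 < crossing u a b ->
  straddle_ge u a (rate * crossing u a b) \/
  straddle_ge u (b + 1) (rate * crossing u a b).
Proof.
move=> cut e0; apply: contrapT => /not_orP[na nb].
have bound c : ~ straddle_ge u c (rate * crossing u a b) ->
    straddle_bound u c (rate * crossing u a b).
  move=> nc i k ic ck ik ui uk; rewrite leNgt; apply/negP => h.
  by apply: nc; exists i, k; split => //; split => //; exact: ltW.
have mu0 : 0 <= rate * crossing u a b by rewrite mulr_ge0// ltW// rate_gt0.
have := crossing_le cut mu0 (bound _ na) (bound _ nb).
have -> : kap * nstraddle * (rate * crossing u a b) = lam * crossing u a b / 2.
  by rewrite /rate; move: nstraddle nstraddle_gt0 => n n0; field; rewrite !gt_eqF.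
have : 0 < lam * crossing u a b by rewrite mulr_gt0.
lra.
Qed.

(** Sites on the same side of a are within r of each other.  If the positive pair
is i, k and the negative pair i', k', with i and i' to the left of a, then
(u_i u_i') (u_k u_k') >= mu ^ 2, so one of the two mixed pairs is large. *)
Lemma straddle_pair u a mu : 0 < mu ->
  straddle_ge u a mu -> straddle_ge (fun i => - u i) a mu ->
  exists p m, [/\ a - r%:Z <= p < a + r%:Z, a - r%:Z <= m < a + r%:Z &
    crossing_pair u p m mu].
Proof.
move=> mu0 [i [k [ia ak ik [ui uk uik]]]] [i' [k' [ia' ak' ik' [ui' uk' uik']]]].
rewrite oppr_gt0 in ui'; rewrite oppr_gt0 in uk'.
have [h|h] := leP mu (u i * - u i').
  exists i, i'; split; last split => //; move: ia ak ik ia' ak' ik'; clear; lia.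
exists k, k'; split; last split => //;
  try by move: ia ak ik ia' ak' ik'; clear; lia.
rewrite leNgt; apply/negP => h'.
have p1 : 0 < u i * - u i' by rewrite mulr_gt0// oppr_gt0.
have p2 : 0 < u k * - u k' by rewrite mulr_gt0// oppr_gt0.
have : (u i * - u i') * (u k * - u k') < mu * mu by rewrite ltr_pM// ltW.
have : mu * mu <= (u i * u k) * (- u i' * - u k') by rewrite ler_pM// ltW.
by lra.
Qed.

(** Half of the ratio obtained in [negative_near], for strictness. *)
Definition negative_rate : R := lam / (2 * ((2 * r).+1%:R * kap)).

Lemma negative_rate_gt0 : 0 < negative_rate.
Proof. by rewrite divr_gt0 ?mulr_gt0. Qed.

(** The cut inequality for A = {j}, divided by the negative number u_j: the
negative neighbours of j outweigh its positive ones, up to the factor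
kap / lam. *)
Lemma negative_near u i j : cut_ineq u -> u j < 0 -> 0 < u i ->
  `|i - j| <= r%:Z ->
  exists k, [/\ `|k - j| <= r%:Z, u k < 0 & negative_rate * u i <= - u k].
Proof.
move=> cut uj ui ij; apply: contrapT => nk.
pose C := kap * (- u j) * (negative_rate * u i).
have C0 : 0 <= C.
  have nui : 0 < negative_rate * u i by rewrite mulr_gt0// negative_rate_gt0.
  by rewrite mulr_ge0 ?(ltW nui)// mulr_ge0 ?(ltW kap0)// oppr_ge0 ltW.
have cost_le k : k \in window j -> pair_cost (u j * u k) <= C.
  rewrite mem_irange => hk; rewrite /pair_cost; case: (ltP (u j * u k) 0) => uu.
    by apply: le_trans C0; rewrite pmulr_rle0// ltW.
  have [uk|uk] := leP 0 (u k).
    have -> : u j * u k = 0 by apply/eqP; rewrite eq_le uu nmulr_rle0// uk.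
    by rewrite mulr0.
  rewrite /C -mulrA ler_pM2l// -mulrNN ler_pM2l ?oppr_gt0// leNgt.
  apply/negP => h; apply: nk; exists k; split => //; last exact: ltW.
  by move: hk; clear; lia.
have iw : i \in window j by rewrite mem_irange; move: ij; clear; lia.
have ji : i \notin [:: j].
  by rewrite inE; apply/eqP => ji; move: ui; rewrite ji ltNge ltW.
have := cut [:: j] isT; rewrite big_seq1 (big_rem i)//= ji.
have -> : pair_cost (u j * u i) = lam * (u j * u i).
  by rewrite /pair_cost leNgt nmulr_rlt0// ui.
have : \sum_(k <- rem i (window j) | k \notin [:: j]) pair_cost (u j * u k)
   <= (2 * r).+1%:R * C.
  rewrite big_seq_cond.
  apply: (@le_trans _ _ (\sum_(k <- window j) C)).
    rewrite [leRHS](big_rem i)//= -[leLHS]add0r lerD//.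
    rewrite [leRHS]big_seq [leRHS]big_mkcond [leLHS]big_mkcond.
    apply: ler_sum => k _; case: (boolP (k \in rem i (window j))) => //= kw.
    by case: ifP => // _; apply/cost_le/(mem_rem kw).
  rewrite big_const_seq count_predT iter_addr_0 -[leLHS]mulr_natl ler_wpM2r//.
  by rewrite ler_nat size_irange//; clear; lia.
have : (2 * r).+1%:R * C = - (lam * (u j * u i)) / 2.
  have : (2 * r).+1%:R != 0 :> R by rewrite pnatr_eq0.
  rewrite /C /negative_rate; move: (_.+1%:R) => n n0.
  by field; rewrite n0 gt_eqF.
have : lam * (u j * u i) < 0 by rewrite pmulr_rlt0// nmulr_rlt0.
by lra.
Qed.

Definition decay u : Prop := forall mu, 0 < mu ->
  exists N, forall p m, N <= p -> N <= m -> ~ crossing_pair u p m mu.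

Definition unbounded u : Prop := forall C, exists b, C <= crossing u 0 b.

(** Otherwise infinitely many disjoint pairs contribute at least mu each. *)
Lemma bounded_decay u : ~ unbounded u -> decay u.
Proof.
move=> nu mu mu0; apply: contrapT => nN; apply: nu => C.
suff step n : exists2 b, 0 <= b & mu *+ n <= crossing u 0 b.
  have [b _ hb] := step (Num.bound `|C / mu|); exists b; apply: le_trans hb.
  by rewrite -mulr_natl -ler_pdivrMr// (le_trans (ler_norm _))// ltW// archi_boundP.
elim: n => [|n [b b0 hb]]; first by exists 0; rewrite ?mulr0n ?crossing_ge0.
have [p [m [hp hm pm]]] : exists p m,
    [/\ b + 1 <= p, b + 1 <= m & crossing_pair u p m mu].
  apply: contrapT => h; apply: nN; exists (b + 1) => p m hp hm pm.
  by apply: h; exists p, m.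
pose b' := Num.max p m.
have [pb mb] : p <= b' /\ m <= b' by rewrite !le_max !lexx orbT.
exists b'; first by move: b0 hp pb; clear; lia.
rewrite mulrS addrC; apply: le_trans (@crossing_superadd u 0 b b' _ _).
- by rewrite lerD// (crossing_ge_pair pm)// ?hp ?hm.
- by move: b0; clear; lia.
- by move: hp pb; clear; lia.
Qed.

Lemma decayN u : decay u -> decay (fun i => - u i).
Proof.
move=> du mu /du [N hN]; exists N => p m hp hm [pm up um h].
apply: (hN m p) => //; split; first by rewrite distrC.
- by rewrite -oppr_lt0.
- by rewrite -oppr_gt0.
- by rewrite mulrC -[u m]opprK.
Qed.

(** Far to the right, take a site with u_j < 0.  A pair straddling j gives a large
positive value near j, so [negative_near] gives a large negative value at some
k near j, and a pair straddling k gives a large positive value near k: together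
they form a crossing pair that [decay] forbids. *)
Lemma no_eventual_straddle u mu (N : int) : cut_ineq u -> decay u ->
  (forall M, exists2 j, M <= j & u j < 0) -> 0 < mu ->
  exists2 b, N <= b & ~ straddle_ge u b mu.
Proof.
move=> cut du osc mu0; apply: contrapT => nb.
have st b : N <= b -> straddle_ge u b mu.
  by move=> Nb; apply: contrapT => h; apply: nb; exists b.
have big_near b : N <= b ->
    exists i, [/\ `|i - b| <= r%:Z, 0 < u i & mu <= u i * u i].
  move=> /st [i [k [ib bk ik [ui uk uik]]]]; have [h|h] := leP (u i) (u k).
    exists k; split => //; first by move: ib bk ik; clear; lia.
    by rewrite (le_trans uik)// ler_pM2r.
  exists i; split => //; first by move: ib bk ik; clear; lia.
  by rewrite (le_trans uik)// ler_pM2l// ltW.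
have nmu0 : 0 < negative_rate * mu by rewrite mulr_gt0// negative_rate_gt0.
have [M hM] := du _ nmu0.
have [j hj uj] := osc (Num.max N M + 2 * r%:Z).
have [Nj Mj] : N + 2 * r%:Z <= j /\ M + 2 * r%:Z <= j by move: hj; clear; lia.
have [|i [ij ui mui]] := big_near j; first by move: Nj; clear; lia.
have [k [kj uk hk]] := negative_near cut uj ui ij.
have [|i' [ik' ui' mui']] := big_near k; first by move: Nj kj; clear; lia.
apply: (hM i' k); [by move: Mj kj ik'; clear; lia|by move: Mj kj; clear; lia|].
split => //; rewrite leNgt; apply/negP => h.
have nr0 := negative_rate_gt0; set nr := negative_rate in h hk nr0.
have uk0 : 0 < - u k by rewrite oppr_gt0.
(* Comparing squares avoids the square roots of u_i ^ 2 and u_i' ^ 2. *)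
have h1 : (u i' * - u k) * (u i' * - u k) < (nr * mu) * (nr * mu).
  by rewrite ltr_pM// ltW// mulr_gt0.
have h2 : (nr * u i) * (nr * u i) <= (- u k) * (- u k).
  by rewrite ler_pM// ltW// mulr_gt0.
have h3 : mu * mu <= (u i * u i) * (u i' * u i') by rewrite ler_pM// ltW.
have h4 := ler_wpM2r (ltW (mulr_gt0 ui' ui')) h2.
have h5 := ler_wpM2l (ltW (mulr_gt0 nr0 nr0)) h3.
by lra.
Qed.

(** If both sides were bounded, choose for each sign a right end that no pair of
that sign and of size mu straddles.  Then, by [straddle_or], every left end far
enough is straddled by such pairs of both signs, so that there are crossing pairs
of size mu arbitrarily far to the left. *)
Lemma unbounded_left_or_right u : cut_ineq u ->
  (exists p m, [/\ `|p - m| <= r%:Z, 0 < u p & u m < 0]) ->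
  (forall M, exists2 j, M <= j & u j < 0) ->
  (forall M, exists2 j, M <= j & 0 < u j) ->
  unbounded u \/ unbounded (u \o -%R).
Proof.
move=> cut [p [m [pm up um]]] oscn oscp; apply: contrapT => /not_orP[nr nl].
have [dr dl] := (bounded_decay nr, bounded_decay nl).
pose a1 := Num.min p m; pose b1 := Num.max p m.
have eta0 : 0 < crossing u a1 b1.
  apply: lt_le_trans (@crossing_ge_pair u a1 b1 p m (u p * - u m) _ _ _).
  - by rewrite mulr_gt0 ?oppr_gt0.
  - by split.
  - by rewrite /a1 /b1; clear; lia.
  - by rewrite /a1 /b1; clear; lia.
have ab1 : a1 <= b1 by rewrite /a1 /b1; clear; lia.
set eta := crossing u a1 b1 in eta0.
pose mu := rate * eta; have mu0 : 0 < mu by rewrite mulr_gt0// rate_gt0.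
have left_of v : cut_ineq v -> decay v -> (forall M, exists2 j, M <= j & v j < 0) ->
    (forall a b, crossing v a b = crossing u a b) ->
    forall a, a <= a1 -> straddle_ge v a mu.
  move=> cutv dv oscv vu a aa1.
  have [c bc nc] := no_eventual_straddle (b1 + 1) cutv dv oscv mu0.
  have le_eta : eta <= crossing v a (c - 1).
    rewrite vu; apply: (@le_trans _ _ (crossing u a b1)).
      exact: crossing_le_left.
    by apply: crossing_le_right; move: bc; clear; lia.
  have weaken d :
      straddle_ge v d (rate * crossing v a (c - 1)) -> straddle_ge v d mu.
    move=> [i [k [? ? ? [? ? h]]]]; exists i, k; split => //; split => //.
    by apply: le_trans h; rewrite ler_pM2l// rate_gt0.
  have [/weaken //|] := straddle_or cutv (lt_le_trans eta0 le_eta).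
  by rewrite subrK => /weaken.
have [N hN] := dl _ mu0.
pose a := Num.min a1 (- N - r%:Z).
have [aa1 aN] : a <= a1 /\ a <= - N - r%:Z by rewrite /a; clear; lia.
have sp := left_of u cut dr oscn (fun _ _ => erefl) a aa1.
have sn : straddle_ge (fun i => - u i) a mu.
  apply: left_of aa1; [exact: cut_ineqN|exact: decayN| |exact: crossingN].
  by move=> M; have [j Mj uj] := oscp M; exists j => //; rewrite oppr_lt0.
have [i [k [hi hk [ik ui uk h]]]] := straddle_pair mu0 sp sn.
apply: (hN (- i) (- k)); [by move: hi aN; clear; lia|by move: hk aN; clear; lia|].
by split; rewrite /= ?opprK//; move: ik; clear; lia.
Qed.

Lemma straddle_finite u a : exists C, forall mu, straddle_ge u a mu -> mu <= C.
Proof.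
pose w := irange (a - r%:Z) (a + r%:Z).
exists (\sum_(i <- w) \sum_(k <- w) `|u i * u k|).
move=> mu [i [k [ia ak ik [ui uk h]]]].
have iw : i \in w by rewrite mem_irange; move: ia ak ik; clear; lia.
have kw : k \in w by rewrite mem_irange; move: ia ak ik; clear; lia.
rewrite (le_trans h)// (le_trans (ler_norm _))// (big_rem i)//= (big_rem k)//=.
by rewrite -addrA lerDl addr_ge0// sumr_ge0// => ? _; rewrite sumr_ge0.
Qed.

(** The end 0 is straddled by finitely many pairs, so once the crossing energy of
[0, b] has outgrown them, the large pairs of both signs given by [straddle_or]
have to straddle b + 1. *)
Lemma eventual_pair u : cut_ineq u -> unbounded u ->
  exists b0, forall b, b0 <= b -> 0 < crossing u 0 b /\
    exists p m, [/\ b + 1 - r%:Z <= p <= b + r%:Z,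
      b + 1 - r%:Z <= m <= b + r%:Z & crossing_pair u p m (rate * crossing u 0 b)].
Proof.
move=> cut unb; have rt0 := rate_gt0.
have [C1 hC1] := straddle_finite u 0.
have [C2 hC2] := straddle_finite (fun i => - u i) 0.
have [b0 hb0] := unb ((`|C1| + `|C2| + 1) / rate).
exists b0 => b b0b.
have {}hb0 : `|C1| + `|C2| + 1 <= rate * crossing u 0 b.
  by rewrite mulrC -ler_pdivrMr// (le_trans hb0)// crossing_le_right.
have lt1 : C1 < rate * crossing u 0 b.
  by apply: lt_le_trans hb0; have := ler_norm C1; have := normr_ge0 C2; lra.
have lt2 : C2 < rate * crossing u 0 b.
  by apply: lt_le_trans hb0; have := ler_norm C2; have := normr_ge0 C1; lra.
have mu0 : 0 < rate * crossing u 0 b.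
  by apply: lt_le_trans hb0; have := normr_ge0 C1; have := normr_ge0 C2; lra.
have e0 : 0 < crossing u 0 b by move: mu0; rewrite pmulr_rgt0.
split=> //.
have sp : straddle_ge u (b + 1) (rate * crossing u 0 b).
  by have [/hC1|//] := straddle_or cut e0; rewrite leNgt lt1.
have sn : straddle_ge (fun i => - u i) (b + 1) (rate * crossing u 0 b).
  have := straddle_or (cut_ineqN cut) (b := b) (a := 0); rewrite crossingN.
  by move=> /(_ e0) [/hC2|//]; rewrite leNgt lt2.
have [p [m [hp hm pm]]] := straddle_pair mu0 sp sn.
by exists p, m; split => //; [move: hp; clear; lia|move: hm; clear; lia].
Qed.

(** Each block of 2r further sites adds at least [rate] times the initial crossing
energy, hence 1 / rate blocks double it. *)
Definition doubling : nat := (Num.bound rate^-1 * (2 * r))%N.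

Lemma doubling_ge : (2 * r <= doubling)%N.
Proof. exact: leq_pmull. Qed.

Lemma crossing_doubling u : cut_ineq u -> unbounded u ->
  exists b0, forall b, b0 <= b ->
    2 * crossing u 0 b <= crossing u 0 (b + doubling%:Z).
Proof.
move=> cut unb; have rt0 := rate_gt0; have [b0 hb0] := eventual_pair cut unb.
exists (Num.max b0 0) => b hb.
have [b0b b_ge0] : b0 <= b /\ 0 <= b by move: hb; clear; lia.
have [e0 _] := hb0 _ b0b.
have step n : (1 + rate * n%:R) * crossing u 0 b <=
    crossing u 0 (b + (n * (2 * r))%:Z).
  elim: n => [|n IH]; first by rewrite mulr0 addr0 mul1r mul0n addr0.
  pose c := b + (n * (2 * r))%:Z.
  have bc : b <= c by rewrite /c; clear; lia.
  have [] := hb0 (c + r%:Z); first by move: b0b bc; clear; lia.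
  move=> _ [p [m [hp hm pm]]].
  have -> : b + (n.+1 * (2 * r))%:Z = c + (2 * r)%:Z by rewrite /c; clear; lia.
  apply: le_trans (@crossing_superadd u 0 c _ _ _); last 2 first.
  - by move: b_ge0 bc; clear; lia.
  - by clear; lia.
  rewrite -natr1 mulrDr mulr1 addrA mulrDl lerD//.
  apply: (@le_trans _ _ (rate * crossing u 0 (c + r%:Z))).
    by rewrite ler_pM2l//; apply: crossing_le_right; move: bc; clear; lia.
  apply: crossing_ge_pair pm _ _; [by move: hp; clear; lia|by move: hm; clear; lia].
apply: le_trans (step _); rewrite ler_pM2r//.
have : 1 < rate * (Num.bound rate^-1)%:R.
  by rewrite mulrC -ltr_pdivrMr// div1r archi_boundP// invr_ge0 ltW.
by lra.
Qed.

Definition growing_crossings u (N : int) (d : nat) (k l : nat -> int) : Prop :=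
  [/\ forall m n, (m <= n)%N -> k m <= k n /\ l m <= l n,
      forall n, N <= k n /\ N <= l n,
      forall n, `|k n.+1 - k n| <= d%:Z
    & forall n, crossing_pair u (k n) (l n) (2 ^+ n)].

(** Since [doubling] is at least 2r, the windows of width 2r around successive
positions do not overlap out of order, which makes both sequences monotone. *)
Lemma unbounded_growing u N : cut_ineq u -> unbounded u ->
  exists k l : nat -> int, growing_crossings u N (doubling + 2 * r) k l.
Proof.
move=> cut unb; have rt0 := rate_gt0.
have [b0 pairs] := eventual_pair cut unb.
have [b1 double] := crossing_doubling cut unb.
have [b2 large] := unb rate^-1.
pose c := Num.max (Num.max b0 b1) (Num.max b2 (N + r%:Z)).
have [cb0 cb1 cb2 cN] : [/\ b0 <= c, b1 <= c, b2 <= c & N + r%:Z <= c].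
  by split; rewrite /c; clear; lia.
pose b (n : nat) := c + (n * doubling)%:Z.
have cb n : c <= b n by rewrite /b; clear; lia.
have large_c : 1 <= rate * crossing u 0 c.
  rewrite mulrC -ler_pdivrMr// div1r (le_trans large)// crossing_le_right//.
have pow n : 2 ^+ n <= rate * crossing u 0 (b n).
  elim: n => [|n IH]; first by rewrite expr0 /b mul0n addr0.
  have -> : b n.+1 = b n + doubling%:Z by rewrite /b; clear; lia.
  have h := double (b n) (le_trans cb1 (cb n)).
  apply: (@le_trans _ _ (rate * (2 * crossing u 0 (b n)))); last first.
    by rewrite ler_pM2l.
  by rewrite exprS mulrCA ler_pM2l.
have pick n : exists pm : int * int,
    [/\ b n + 1 - r%:Z <= pm.1 <= b n + r%:Z, b n + 1 - r%:Z <= pm.2 <= b n + r%:Z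
      & crossing_pair u pm.1 pm.2 (2 ^+ n)].
  have [_ [p [m [hp hm [? ? ? h]]]]] := pairs (b n) (le_trans cb0 (cb n)).
  by exists (p, m); split => //; split => //; exact: le_trans h.
have [f hf] := choice pick.
have dbl := doubling_ge.
exists (fst \o f), (snd \o f); split => [||n|n] /=.
- have incr (g : nat -> int) : (forall n, b n + 1 - r%:Z <= g n <= b n + r%:Z) ->
      forall m n, (m <= n)%N -> g m <= g n.
    move=> hg; apply: (homo_leq (r := <=%R)); [exact: lexx|exact: le_trans|].
    by move=> n; move: (hg n) (hg n.+1) dbl; rewrite /b mulSn; clear; lia.
  by move=> m n mn; split; apply: (incr (fun n => _)) mn => i; have [] := hf i.
- by move=> n; have [h1 h2 _] := hf n; move: (cb n) cN h1 h2; clear; lia.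
- have [h1 _ _] := hf n; have [h2 _ _] := hf n.+1.
  by move: h1 h2; rewrite /b mulSn; clear; lia.
- by have [] := hf n.
Qed.

End Crossings.

(** * Minimizers of pair interactions *)

Section PairInteraction.
Variables (R : archiRealFieldType) (lam kap : R).
Hypotheses (lam0 : 0 < lam) (lamkap : lam <= kap).

(** The consequences of the bounds on the second derivatives of a pair energy g
that the proof uses: the mixed difference of g is that of - c times the product
of the variables for some c in [lam, kap], and the second difference in each
variable is bounded above. *)
Definition twist_pair (g : R -> R -> R) : Prop :=
  [/\ forall s1 s2 t1 t2, exists c, lam <= c <= kap /\
        g s1 t2 + g s2 t1 - g s1 t1 - g s2 t2 = c * ((s1 - s2) * (t1 - t2)),
      forall z t w, 0 < t ->
        g (z + t) w + g (z - t) w - 2 * g z w <= 2 * kap * t ^+ 2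
    & forall z t w, 0 < t ->
        g w (z + t) + g w (z - t) - 2 * g w z <= 2 * kap * t ^+ 2].

Lemma twist_swap_le g s1 s2 t1 t2 : twist_pair g ->
  g s1 t2 + g s2 t1 - g s1 t1 - g s2 t2 <=
  pair_cost lam kap ((s1 - s2) * (t1 - t2)).
Proof.
move=> [/(_ s1 s2 t1 t2)[c [/andP[lc ck] ->]] _ _].
rewrite /pair_cost; case: (leP 0 (_ * _)) => h; first by rewrite ler_wpM2r.
by rewrite ler_wnM2r// ltW.
Qed.

(** Moving the first arguments of g apart by 2t, the larger one facing the larger
of w and w', gains to first order in t and loses only to second order. *)
Lemma twist_push_fst_le g z t w w' : twist_pair g -> 0 < t -> w' <= w ->
  g (z + t) w + g (z - t) w' - g z w - g z w' <=
  2 * kap * t ^+ 2 - lam * t * (w - w').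
Proof.
move=> [rect push _] t0 ww.
have [c [/andP[lc _] hc]] := rect (z + t) z w w'; have := push z t w' t0.
have : lam * (t * (w - w')) <= c * (t * (w - w')).
  by rewrite ler_wpM2r// mulr_ge0 ?subr_ge0// ltW.
by move: hc; rewrite [z + t - z]addrAC subrr add0r; lra.
Qed.

Lemma twist_push_snd_le g z t w w' : twist_pair g -> 0 < t -> w' <= w ->
  g w (z + t) + g w' (z - t) - g w z - g w' z <=
  2 * kap * t ^+ 2 - lam * t * (w - w').
Proof.
move=> [rect _ push] t0 ww.
have [c [/andP[lc _] hc]] := rect w w' (z + t) z; have := push z t w' t0.
have : lam * ((w - w') * t) <= c * ((w - w') * t).
  by rewrite ler_wpM2r// mulr_ge0 ?subr_ge0// ltW.
by move: hc; rewrite [z + t - z]addrAC subrr add0r; lra.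
Qed.

Variables (r : nat) (g : 'I_r -> R -> R -> R).
Hypothesis twist : forall m, twist_pair (g m).

Definition energy (i0 i1 : int) (z : int -> R) : R :=
  \sum_(i <- irange (i0 - r%:Z) i1) \sum_(m < r) g m (z i) (z (i + m.+1%:Z)).

Definition minimizer (x : int -> R) : Prop := forall i0 i1 z, i0 <= i1 ->
  (forall i, ~~ (i0 <= i <= i1) -> z i = x i) ->
  energy i0 i1 x <= energy i0 i1 z.

(** The two inequalities are added because, when z and z' exchange x and y at some
sites, the contributions that depend on a single site cancel in the sum. *)
Lemma two_competitors x y i0 i1 z z' : minimizer x -> minimizer y -> i0 <= i1 ->
  (forall i, ~~ (i0 <= i <= i1) -> z i = x i) ->
  (forall i, ~~ (i0 <= i <= i1) -> z' i = y i) ->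
  0 <= \sum_(i <- irange (i0 - r%:Z) i1) \sum_(m < r)
    (g m (z i) (z (i + m.+1%:Z)) + g m (z' i) (z' (i + m.+1%:Z))
     - g m (x i) (x (i + m.+1%:Z)) - g m (y i) (y (i + m.+1%:Z))).
Proof.
move=> minx miny i01 zx z'y.
have hx := minx _ _ _ i01 zx; have hy := miny _ _ _ i01 z'y.
under eq_bigr => i _ do rewrite sumrB sumrB big_split /=.
rewrite sumrB sumrB big_split /=; move: hx hy; rewrite /energy; lra.
Qed.

Lemma seq_int_bounded (A : seq int) :
  exists N : nat, forall i, i \in A -> - N%:Z <= i <= N%:Z.
Proof.
elim: A => [|j A [N hN]]; first by exists 0%N.
exists (maxn N `|j|)%N => i; rewrite inE => /predU1P[->|/hN]; lia.
Qed.

Lemma sum_window (A : seq int) (F : int -> R) k : k \in A ->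
  \sum_(j <- window r k | j \notin A) F j =
  \sum_(m < r) ((if k + m.+1%:Z \notin A then F (k + m.+1%:Z) else 0) +
               (if k - m.+1%:Z \notin A then F (k - m.+1%:Z) else 0)).
Proof.
move=> kA.
pose up := [seq k + m.+1%:Z | m <- iota 0 r].
pose dn := [seq k - m.+1%:Z | m <- iota 0 r].
have -> : \sum_(j <- window r k | j \notin A) F j =
    \sum_(j <- k :: up ++ dn | j \notin A) F j.
  apply/perm_big/uniq_perm; first exact: uniq_irange.
    rewrite /= mem_cat cat_uniq !map_inj_uniq ?iota_uniq; try by move=> m n; lia.
    rewrite andbT andTb; apply/andP; split.
      by apply/negP => /orP[] /mapP[m _]; lia.
    by apply/hasPn => j /mapP[m _ ->]; apply/negP => /mapP[n _]; lia.
  move=> j; rewrite mem_irange inE mem_cat; apply/idP/idP => [h|].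
    case: (ltgtP j k) => jk; rewrite ?orbT//=; apply/orP.
      by right; apply/mapP; exists `|k - j|.-1%N; rewrite ?mem_iota; lia.
    by left; apply/mapP; exists `|k - j|.-1%N; rewrite ?mem_iota; lia.
  by move=> /or3P[/eqP|/mapP[m]|/mapP[m]]; rewrite ?mem_iota; lia.
rewrite big_cons kA /= big_cat /= !big_map.
rewrite [X in X + _ = _]big_mkcond [X in _ + X = _]big_mkcond -big_split /=.
by rewrite -{1}[r]subn0 -/(index_iota 0 r) big_mkord.
Qed.

Lemma big_seq_in (A w : seq int) (F : int -> R) : uniq A -> uniq w ->
  {subset A <= w} -> \sum_(i <- A) F i = \sum_(i <- w) (if i \in A then F i else 0).
Proof.
move=> uA uw Aw; rewrite -big_mkcond -[RHS]big_filter; apply: perm_big.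
apply: uniq_perm; rewrite ?filter_uniq// => i; rewrite mem_filter.
by case: (boolP (i \in A)) => // /Aw ->.
Qed.

(** A separated pair appears in the energy at its left site and in the cut
inequality at its site in A; the terms for which this is the right site are
reindexed. *)
Lemma minimizers_cut_ineq x y : minimizer x -> minimizer y ->
  cut_ineq r lam kap (fun i => x i - y i).
Proof.
move=> minx miny A uA; pose u i := x i - y i.
have [N hN] := seq_int_bounded A.
pose z i := if i \in A then y i else x i; pose z' i := if i \in A then x i else y i.
have NN : - N%:Z <= N%:Z by lia.
have out i : ~~ (- N%:Z <= i <= N%:Z) -> (i \in A) = false.
  by move=> h; apply: contraNF h => /hN.
have := @two_competitors x y _ _ z z' minx miny NN.
move=> /(_ _ _)/le_trans; apply.
- by move=> i /out; rewrite /z => ->.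
- by move=> i /out; rewrite /z' => ->.
pose c i k := pair_cost lam kap (u i * u k).
have cC i k : c i k = c k i by rewrite /c mulrC.
set w := irange _ _.
pose first := \sum_(m < r) \sum_(i <- A)
  if i + m.+1%:Z \notin A then c i (i + m.+1%:Z) else 0.
pose second := \sum_(m < r) \sum_(i <- A)
  if i - m.+1%:Z \notin A then c i (i - m.+1%:Z) else 0.
apply: (@le_trans _ _ (first + second)); last first.
  rewrite [leRHS]big_seq /= le_eqVlt; apply/orP; left; apply/eqP.
  under [RHS]eq_bigr => k kA do rewrite sum_window//.
  rewrite -[RHS]big_seq exchange_big /= /first /second -big_split /=.
  by apply: eq_bigr => m _; rewrite -big_split.
have uw : uniq w by exact: uniq_irange.
have -> : first = \sum_(m < r) \sum_(i <- w)
    (if (i \in A) && (i + m.+1%:Z \notin A) then c i (i + m.+1%:Z) else 0).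
  apply: eq_bigr => m _; rewrite (big_seq_in _ uA uw).
    by apply: eq_bigr => i _; case: (i \in A).
  by move=> i /hN; rewrite mem_irange; clear; lia.
have -> : second = \sum_(m < r) \sum_(i <- w)
    (if (i \notin A) && (i + m.+1%:Z \in A) then c i (i + m.+1%:Z) else 0).
  apply: eq_bigr => m _; pose sh i := i - m.+1%:Z.
  pose G i := if i \notin A then c i (i + m.+1%:Z) else 0.
  transitivity (\sum_(i <- map sh A) G i).
    by rewrite big_map; apply: eq_bigr => i _; rewrite /G /sh subrK cC.
  have ush : injective sh by move=> i j; rewrite /sh; lia.
  have uA' : uniq (map sh A) by rewrite map_inj_uniq.
  rewrite (big_seq_in _ uA' uw).
    apply: eq_bigr => i _; rewrite -{1}[i](addrK m.+1%:Z) (mem_map ush) /G.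
    by case: (i \in A); case: (_ \in A).
  move=> i /mapP[j /hN + ->]; rewrite mem_irange /sh.
  by have := ltn_ord m; clear; lia.
rewrite ![\sum_(m < r) \sum_(i <- w) _]exchange_big -big_split /=.
apply: ler_sum => i _; rewrite -big_split; apply: ler_sum => m _ /=.
set k := i + _.
have cost : g m (x i) (y k) + g m (y i) (x k)
    - g m (x i) (x k) - g m (y i) (y k) <= c i k.
  exact: twist_swap_le.
by rewrite /z /z'; case: (i \in A); case: (k \in A) => /=; move: cost; lra.
Qed.

Hypothesis r0 : (0 < r)%N.

Lemma last_positive (u : int -> R) p q : p < q -> 0 < u p ->
  exists p', [/\ p' < q, 0 < u p' & forall i, p' < i -> i < q -> u i <= 0].
Proof.
move=> pq up; have ex : exists n : nat, 0 < u (q - n.+1%:Z).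
  by exists `|q - p|.-1%N; rewrite (_ : q - _ = p)//; lia.
case: (ex_minnP ex) => n un min_n; exists (q - n.+1%:Z).
split => //; first by clear; lia.
move=> i hi iq; rewrite leNgt; apply/negP => ui.
have := min_n `|q - i|.-1%N.
rewrite (_ : q - (`|q - i|.-1%N).+1%:Z = i); last by move: iq; clear; lia.
by move=> /(_ ui); move: hi iq; clear; lia.
Qed.

(** Otherwise, let j be the site after the last positive site p1 before q; the
absence of crossing pairs forces u_j = 0.  Let A be the set of negative sites
between p1 and s.  Outside A, no site within r of A or of j has u < 0, since
p1 and s keep the other negative sites away; so exchanging x and y on A costs
nothing, and after the exchange the difference z - z' is nonnegative near j and
positive at p1.  Moving z_j up and z'_j down by t then gains an amount of order
t and costs one of order t ^ 2. *)
Lemma sign_change_crossing x y p q s : minimizer x -> minimizer y ->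
  p < q -> q < s -> y p < x p -> x q < y q -> y s < x s ->
  exists i k, [/\ `|i - k| <= r%:Z, 0 < x i - y i & x k - y k < 0].
Proof.
move=> minx miny pq qs xp xq xs; pose u i := x i - y i; apply: contrapT => nc.
have sep i k : 0 < u i -> u k < 0 -> r%:Z < `|i - k|.
  by move=> ui uk; rewrite ltNge; apply/negP => ik; apply: nc; exists i, k.
have [||p1 [p1q up1 p1max]] := @last_positive u p q; rewrite ?subr_gt0//.
have uq : u q < 0 by rewrite subr_lt0.
have us : 0 < u s by rewrite subr_gt0.
pose j := p1 + 1.
have uj : u j = 0.
  apply/eqP; rewrite eq_le; apply/andP; split.
    have [jq|jq] := ltP j q; first by apply: p1max => //; rewrite /j; clear; lia.
    by rewrite (_ : j = q) ?ltW//; move: jq p1q; rewrite /j; clear; lia.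
  rewrite leNgt; apply/negP => /(sep _ _ up1); rewrite /j; move: r0; clear; lia.
pose A i := (p1 < i < s) && (u i < 0).
have Aj : A j = false by rewrite /A uj ltxx andbF.
have near_j k : `|k - j| <= r%:Z -> ~~ A k -> 0 <= u k.
  move=> kj; rewrite /A negb_and -leNgt => /orP[ks|//].
  rewrite leNgt; apply/negP => uk.
  move: (sep _ _ up1 uk) (sep _ _ us uk) ks kj p1q qs; rewrite /j; clear; lia.
have near_A i k : A i -> `|k - i| <= r%:Z -> ~~ A k -> 0 <= u k.
  move=> /andP[hi ui] ki; rewrite /A negb_and -leNgt => /orP[ks|//].
  by move: (sep _ _ up1 ui) (sep _ _ us ui) ki ks hi; clear; lia.
pose tj t i := if i == j then t else 0 : R.
pose z t i := (if A i then y i else x i) + tj t i.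
pose z' t i := (if A i then x i else y i) - tj t i.
have p1s : p1 <= s by move: p1q qs; clear; lia.
have out t i : ~~ (p1 <= i <= s) -> A i = false /\ tj t i = 0.
  move=> hi; split; first by apply: contraNF hi => /andP[]; clear; lia.
  by rewrite /tj; case: eqP => // ij; move: hi ij p1q qs; rewrite /j; clear; lia.
pose w := irange (p1 - r%:Z) s; pose m0 := Ordinal r0.
(* The first order gain is used at a single pair, the one of p1 and j. *)
pose gain t (i : int) (m : 'I_r) :=
  if (i == p1) && (m == m0) then lam * t * u p1 else 0.
have pair_le t (i : int) (m : 'I_r) : 0 < t ->
  g m (z t i) (z t (i + m.+1%:Z)) + g m (z' t i) (z' t (i + m.+1%:Z))
  - g m (x i) (x (i + m.+1%:Z)) - g m (y i) (y (i + m.+1%:Z)) <=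
  2 * kap * t ^+ 2 - gain t i m.
  move=> t0; set k := i + _.
  have kap0 : 0 < kap := lt_le_trans lam0 lamkap.
  have kt0 : 0 < 2 * kap * t ^+ 2 by rewrite !mulr_gt0// exprn_gt0.
  have ik : `|k - i| <= r%:Z by rewrite /k; have := ltn_ord m; clear; lia.
  have zz l : `|l - j| <= r%:Z -> l != j -> z' t l <= z t l.
    move=> lj /negbTE hl; rewrite /z /z' /tj hl subr0 addr0.
    case: ifPn => [/andP[_ ul]|Al]; first by rewrite -subr_le0 ltW.
    by rewrite -subr_ge0; exact: near_j Al.
  have xyj : x j = y j by apply/eqP; rewrite -subr_eq0; apply/eqP.
  have [ij|ij] := eqVneq i j.
    have kj : k != j by rewrite -ij /k; clear; lia.
    have zk : z' t k <= z t k by apply: zz => //; rewrite -ij.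
    have -> : gain t i m = 0 by rewrite /gain ij /j; case: eqP => //; clear; lia.
    have zi : z t i = x j + t by rewrite /z /tj ij eqxx Aj.
    have z'i : z' t i = x j - t by rewrite /z' /tj ij eqxx Aj xyj.
    have := twist_push_fst_le (x j) (twist m) t0 zk.
    have : 0 <= lam * t * (z t k - z' t k) by rewrite !mulr_ge0 ?subr_ge0// ltW.
    have : g m (x j) (z t k) + g m (x j) (z' t k) =
        g m (x j) (x k) + g m (x j) (y k).
      rewrite /z /z' /tj (negbTE kj) subr0 addr0; case: (A k) => //; exact: addrC.
    by rewrite zi z'i ij -xyj; lra.
  have [kj|kj] := eqVneq k j.
    have zi : z' t i <= z t i by apply: zz => //; rewrite -kj distrC.
    have zk : z t k = x j + t by rewrite /z /tj kj eqxx Aj.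
    have z'k : z' t k = x j - t by rewrite /z' /tj kj eqxx Aj xyj.
    have := twist_push_snd_le (x j) (twist m) t0 zi.
    have : gain t i m <= lam * t * (z t i - z' t i).
      rewrite /gain; case: ifP => [/andP[/eqP ip1 _]|_]; last first.
        by rewrite !mulr_ge0 ?subr_ge0// ltW.
      have Ap1 : A p1 = false by rewrite /A ltxx.
      by rewrite /z /z' /tj (negbTE ij) subr0 addr0 ip1 Ap1.
    have : g m (z t i) (x j) + g m (z' t i) (x j) =
        g m (x i) (x j) + g m (y i) (x j).
      rewrite /z /z' /tj (negbTE ij) subr0 addr0; case: (A i) => //; exact: addrC.
    by rewrite zk z'k kj -xyj; lra.
  have -> : gain t i m = 0.
    rewrite /gain; case: eqP => //= ip1; case: eqP => // mm; move: kj.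
    by rewrite /k ip1 mm /= /j eqxx.
  rewrite /z /z' /tj (negbTE ij) (negbTE kj) !subr0 !addr0.
  have cost : u i * u k <= 0 -> g m (x i) (y k) + g m (y i) (x k)
      - g m (x i) (x k) - g m (y i) (y k) <= 0.
    move=> uu; apply: le_trans (twist_swap_le _ _ _ _ (twist m)) _.
    rewrite /pair_cost -/(u i) -/(u k); case: (leP 0 (_ * _)) => h.
      by have -> : u i * u k = 0; [apply/eqP; rewrite eq_le uu h|rewrite mulr0].
    by rewrite pmulr_rle0.
  case: (boolP (A i)) => Ai; case: (boolP (A k)) => Ak; try lra.
    have : u i * u k <= 0.
      by rewrite nmulr_rle0 ?(near_A i)//; have /andP[] := Ai.
    by move=> /cost; lra.
  have : u i * u k <= 0.
    by rewrite nmulr_lle0 ?(near_A k) 1?distrC//; have /andP[] := Ak.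
  by move=> /cost; lra.
have total t : 0 < t ->
    lam * t * u p1 <= \sum_(i <- w) \sum_(m < r) 2 * kap * t ^+ 2.
  move=> t0.
  have h : 0 <= \sum_(i <- w) \sum_(m < r) (2 * kap * t ^+ 2 - gain t i m).
    apply: le_trans (@two_competitors x y _ _ (z t) (z' t) minx miny p1s _ _) _.
    - by move=> i /(out t)[hA ht]; rewrite /z hA ht addr0.
    - by move=> i /(out t)[hA ht]; rewrite /z' hA ht subr0.
    by apply: ler_sum => i _; apply: ler_sum => m _; exact: pair_le.
  have : \sum_(i <- w) \sum_(m < r) gain t i m = lam * t * u p1.
    rewrite (bigD1_seq p1) ?uniq_irange ?mem_irange//=; last first.
      by move: p1s; clear; lia.
    rewrite (bigD1 m0)//= {1}/gain !eqxx/=.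
    rewrite !big1 ?addr0// => [i /negbTE hi|m /negbTE hm].
      by rewrite big1// => m _; rewrite /gain hi.
    by rewrite /gain hm andbF.
  move: h; under eq_bigr => i _ do rewrite sumrB.
  by rewrite sumrB; lra.
pose n := (size w * r)%:R : R; have n0 : 0 <= n by exact: ler0n.
have {}total t : 0 < t -> lam * t * u p1 <= n * (2 * kap * t ^+ 2).
  move=> /total/le_trans; apply; rewrite big_const_seq count_predT iter_addr_0.
  by rewrite sumr_const card_ord -mulrnA [leRHS]mulr_natl mulnC.
have kap0 : 0 < kap := lt_le_trans lam0 lamkap.
pose M := 2 * kap * n + 1.
have M0 : 0 < M.
  by apply: ltr_pwDr => //; rewrite mulr_ge0// mulr_ge0// ltW.
(* Half of the threshold below which the first order gain wins. *)
pose t := lam * u p1 / (2 * M).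
have lu0 : 0 < lam * u p1 by rewrite mulr_gt0.
have t0 : 0 < t by rewrite divr_gt0 ?mulr_gt0.
have Mt : M * t = lam * u p1 / 2 by rewrite /t; field; rewrite gt_eqF.
have := total _ t0.
have -> : lam * t * u p1 = t * (2 * (M * t)) by rewrite Mt; field.
have : 0 < t * t by rewrite mulr_gt0.
have -> : n * (2 * kap * t ^+ 2) = (M - 1) * (t * t) by rewrite /M; ring.
have := mulr_gt0 M0 (mulr_gt0 t0 t0).
by lra.
Qed.

End PairInteraction.

(** * Local energies as pair interactions *)

Section SmoothPair.
Variables (R : realType) (lam kap : R).

Lemma mean_value (g dg : R -> R) a b : (forall t : R, is_derive t 1 g (dg t)) ->
  a <= b -> exists2 c, a <= c <= b & g b - g a = dg c * (b - a).
Proof.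
move=> hg ab; have cont : {within `[a, b], continuous g}.
  by apply: derivable_within_continuous => t _; have [] := hg t.
have [c] := MVT_segment ab (fun t _ => hg t) cont.
by rewrite in_itv /= => hc ->; exists c.
Qed.

Lemma mean_value_any (g dg : R -> R) a b : (forall t : R, is_derive t 1 g (dg t)) ->
  exists c, g b - g a = dg c * (b - a).
Proof.
move=> hg; have [ab|/ltW ba] := leP a b.
  by have [c _ hc] := mean_value hg ab; exists c.
have [c _ hc] := mean_value hg ba; exists c.
by rewrite -opprB hc -mulrN opprB.
Qed.

Lemma second_difference_le (g dg ddg : R -> R) z t :
  (forall s : R, is_derive s 1 g (dg s)) ->
  (forall s : R, is_derive s 1 dg (ddg s)) ->
  (forall s : R, `|ddg s| <= kap) -> 0 < t ->
  g (z + t) + g (z - t) - 2 * g z <= 2 * kap * t ^+ 2.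
Proof.
move=> hg hdg bound t0.
have [|c1 /andP[c1l c1u] h1] := mean_value hg (a := z) (b := z + t); first by lra.
have [|c2 /andP[c2l c2u] h2] := mean_value hg (a := z - t) (b := z); first by lra.
have [|c _ hc] := mean_value hdg (a := c2) (b := c1); first by lra.
have hb := le_trans (ler_norm _) (bound c).
have : ddg c * (c1 - c2) <= kap * (2 * t).
  apply: (@le_trans _ _ (`|ddg c| * (c1 - c2))).
    by rewrite ler_wpM2r ?ler_norm//; lra.
  by apply: ler_pM; rewrite ?normr_ge0//; lra.
rewrite -hc => /(ler_wpM2r (ltW t0)).
have -> : g (z + t) + g (z - t) - 2 * g z = (dg c1 - dg c2) * t.
  by move: h1 h2; rewrite [z + t - z]addrAC subrr add0r; lra.
by move/le_trans; apply; rewrite le_eqVlt; apply/orP; left; apply/eqP; ring.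
Qed.

Lemma point2_shift_fst (s t h : R) :
  point2 (h + s) t = h *: delta_mx 0 0 + point2 s t.
Proof.
apply/rowP => k; rewrite !mxE /=; have [_|_] := eqVneq k 0.
  by rewrite mulr1.
by rewrite mulr0 add0r.
Qed.

Lemma point2_shift_snd (s t h : R) :
  point2 s (h + t) = h *: delta_mx 0 1 + point2 s t.
Proof.
apply/rowP => k; rewrite !mxE /=; have [->|k0] := eqVneq k 0.
  by rewrite mulr0 add0r.
have -> : k = 1 by move: k k0; do 2?case=> //; case=> // *; exact: val_inj.
by rewrite mulr1.
Qed.

Lemma is_derive_fst (f : 'rV[R]_2 -> R) (s t : R) : partials_cont f ->
  is_derive s 1 (fun s => f (point2 s t)) (partial 0 f (point2 s t)).
Proof.
move=> hf; have [/(_ (point2 s t)) df _] := hf 0.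
have E : (fun h => h^-1 *: (((fun s => f (point2 s t)) \o shift s) (h *: (1 : R))
             - f (point2 s t))) =
         (fun h => h^-1 *: ((f \o shift (point2 s t)) (h *: delta_mx 0 0)
             - f (point2 s t))).
  apply/funext => h /=; congr (_ *: (f _ - _)).
  by rewrite [h *: 1]mulr1 point2_shift_fst.
by split; rewrite /derivable /partial /derive E.
Qed.

Lemma is_derive_snd (f : 'rV[R]_2 -> R) (s t : R) : partials_cont f ->
  is_derive t 1 (fun t => f (point2 s t)) (partial 1 f (point2 s t)).
Proof.
move=> hf; have [/(_ (point2 s t)) df _] := hf 1.
have E : (fun h => h^-1 *: (((fun t => f (point2 s t)) \o shift t) (h *: (1 : R))
             - f (point2 s t))) =
         (fun h => h^-1 *: ((f \o shift (point2 s t)) (h *: delta_mx 0 1)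
             - f (point2 s t))).
  apply/funext => h /=; congr (_ *: (f _ - _)).
  by rewrite [h *: 1]mulr1 point2_shift_snd.
by split; rewrite /derivable /partial /derive E.
Qed.

(** The mean value theorem is applied in the second variable and then in the first,
so that the derivative which appears is the one that the twist condition
bounds. *)
Lemma smooth_twist_pair (f : 'rV[R]_2 -> R) : C2 f ->
  (forall (i k : 'I_2) a, `|partial i (partial k f) a| <= kap) ->
  (forall s t, partial 0 (partial 1 f) (point2 s t) <= - lam) ->
  twist_pair lam kap (fun s t => f (point2 s t)).
Proof.
move=> [_ df ddf] bound twist; split => [s1 s2 t1 t2|z t w t0|z t w t0].
- have [eta heta] := @mean_value_any (fun t => f (point2 s1 t) - f (point2 s2 t))
    (fun t => partial 1 f (point2 s1 t) - partial 1 f (point2 s2 t)) t1 t2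
    (fun t => is_deriveB (is_derive_snd s1 t df) (is_derive_snd s2 t df)).
  have [xi hxi] := mean_value_any s2 s1 (fun s => is_derive_fst s eta (ddf 1)).
  exists (- partial 0 (partial 1 f) (point2 xi eta)); split.
    have := twist xi eta; have := bound 0 1 (point2 xi eta).
    by rewrite ler_norml => /andP[]; lra.
  by move: heta; rewrite hxi; lra.
- exact: second_difference_le (fun s => is_derive_fst s w df)
    (fun s => is_derive_fst s w (ddf 0)) (fun s => bound 0 0 _) t0.
- exact: second_difference_le (fun s => is_derive_snd w s df)
    (fun s => is_derive_snd w s (ddf 1)) (fun s => bound 1 1 _) t0.
Qed.

End SmoothPair.

Lemma local_energy_pairs (R : realType) (r : nat) (K lam : R)
    (S : 'rV[R]_r.+1 -> R) :
  (0 < r)%N -> local_energy K lam S ->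
  exists g : 'I_r -> R -> R -> R,
    [/\ lam <= K / r%:R, forall m, twist_pair lam (K / r%:R) (g m)
      & forall x, global_minimizer S x -> minimizer g x].
Proof.
move=> r0 [_ [f [fC2 SE hf]]]; exists (fun m s t => f m (point2 s t)).
have box i0 i1 z : box_energy S [set i | i0 - r%:Z <= i <= i1] z =
    energy (fun m s t => f m (point2 s t)) i0 i1 z.
  rewrite /box_energy /energy.
  have -> : [set i | i0 - r%:Z <= i <= i1] = [set` irange (i0 - r%:Z) i1].
    by apply/seteqP; split => i /=; rewrite mem_irange.
  rewrite -fsbig_seq ?uniq_irange//; apply: eq_bigr => i _.
  rewrite /site_energy SE; apply: eq_bigr => m _.
  by rewrite !mxE /= addr0.
split=> [|m|x minx i0 i1 z i01 zx].
- have [_ bound _ tw] := hf (Ordinal r0).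
  have := tw 0 0; have := bound 0 1 (point2 0 0).
  by rewrite ler_norml => /andP[]; lra.
- by have [_ bound _ tw] := hf m; exact: smooth_twist_pair.
have := minx i0 i1 (fun i => z i - x i) i01.
rewrite (_ : (fun i => x i + (z i - x i)) = z); last first.
  by apply/funext => i; rewrite addrC subrK.
by rewrite !box; apply => i /zx ->; rewrite subrr.
Qed.

(** * Crossing domains *)

Section CrossingDomain.
Variable R : realType.
Implicit Types (x y : int -> R) (D H I : set int).

Lemma interval_in_component D I : is_interval I -> I !=set0 -> I `<=` ~` D ->
  exists2 C, int_component (~` D) C & I `<=` C.
Proof.
move=> itvI [i0 Ii0] ID.
pose C := [set i | forall k, (i0 <= k <= i) \/ (i <= k <= i0) -> ~ D k].
have IC : I `<=` C.
  move=> i Ii k [] hk; apply: ID; [exact: itvI hk|exact: itvI hk].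
exists C => //; split; first by exists i0; exact: IC.
- move=> i j Ci Cj k kij l hl.
  have : ((i0 <= l <= i) \/ (i <= l <= i0)) \/ ((i0 <= l <= j) \/ (j <= l <= i0)).
    by move: kij hl; clear; lia.
  by move=> [/Ci|/Cj].
- by move=> i Ci; apply: Ci; clear; lia.
- move=> C' itvC' C'D CC'; apply/seteqP; split => // i C'i k [] hk; apply: C'D.
  + by apply: itvC' hk => //; apply/CC'/IC.
  + by apply: itvC' hk => //; apply/CC'/IC.
Qed.

(** Components can be replaced by arbitrary intervals, which are easier to cut and
to reflect. *)
Lemma ordered_outsideP x y D : ordered_outside x y D <->
  forall I, is_interval I -> I `<=` ~` D -> weakly_ordered_on I x y.
Proof.
split=> [ord I itvI ID|ord C [_ itvC CD _]]; last exact: ord.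
have [I0|/set0P I0] := eqVneq I set0; first by left => i; rewrite I0.
have [C /ord hC IC] := interval_in_component itvI I0 ID.
by case: hC => h; [left|right] => i /IC /h.
Qed.

(** H is a ray that meets D without containing all of it.  If x and y were ordered on H,
then D without H would be a smaller interval with the same property: an interval
that avoids it either avoids D or lies in H. *)
Lemma crossing_domain_sign_change x y D H : crossing_domain x y D ->
  is_interval H -> is_interval (~` H) ->
  D `&` H !=set0 -> D `&` ~` H !=set0 -> ~ weakly_ordered_on H x y.
Proof.
move=> [itvD /ordered_outsideP ordD minD] itvH itvH' [c [Dc Hc]] [j [Dj H'j]] ordH.
have DH : D `&` ~` H = D.
  apply: minD; last by move=> i [].
    by move=> i k [? ?] [? ?] l hl; split; [exact: itvD hl|exact: itvH' hl].
  apply/ordered_outsideP => I itvI ID.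
  have [ID'|] := pselect (I `<=` ~` D); first exact: ordD.
  move=> /existsNP[c' /not_implyP[Ic' /contrapT Dc']].
  have Hc' : H c' by apply: contrapT => h; exact: ID Ic' _.
  suff IH : I `<=` H by case: ordH => h; [left|right] => i /IH /h.
  move=> i Ii; apply: contrapT => H'i.
  have nj : ~ I j by move=> /ID; apply.
  have nD : ~ D i by move=> Di; exact: ID Ii _.
  have : (i <= j <= c') \/ (c' <= j <= i) \/ (j <= i <= c') \/ (c' <= i <= j)
     \/ (i <= c' <= j) \/ (j <= c' <= i) by clear; lia.
  move=> [h|[h|[h|[h|[h|h]]]]].
  - by apply: nj; exact: itvI h.
  - by apply: nj; exact: itvI h.
  - by apply: nD; exact: itvD h.
  - by apply: nD; exact: itvD h.
  - by apply: (itvH' _ _ H'i H'j _ h).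
  - by apply: (itvH' _ _ H'j H'i _ h).
by move: Dc; rewrite -DH => -[_].
Qed.

Lemma is_interval_opp D : is_interval D -> is_interval (-%R @^-1` D).
Proof. by move=> h i j /= Di Dj k kij; apply: h Dj Di _ _; lia. Qed.

Lemma ordered_outside_opp x y D : ordered_outside x y D ->
  ordered_outside (x \o -%R) (y \o -%R) (-%R @^-1` D).
Proof.
move=> /ordered_outsideP ord; apply/ordered_outsideP => I itvI ID.
have := ord (-%R @^-1` I) (is_interval_opp itvI).
have ID' : -%R @^-1` I `<=` ~` D by move=> i /= /ID; rewrite /= opprK.
by move=> /(_ ID')[] h; [left|right] => i Ii /=; apply: h; rewrite /= opprK.
Qed.

Lemma preimage_oppK D : -%R @^-1` (-%R @^-1` D) = D :> set int.
Proof. by apply/seteqP; split => i /=; rewrite opprK. Qed.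

Lemma crossing_domain_opp x y D : crossing_domain x y D ->
  crossing_domain (x \o -%R) (y \o -%R) (-%R @^-1` D).
Proof.
move=> [itvD ordD minD].
split; [exact: is_interval_opp|exact: ordered_outside_opp|].
move=> D' itvD' ordD' D'D; rewrite -(preimage_oppK D') (minD (-%R @^-1` D'))//.
- exact: is_interval_opp.
- have := ordered_outside_opp ordD'; congr ordered_outside;
    by apply/funext => i /=; rewrite opprK.
- by move=> i /= /D'D; rewrite /= opprK.
Qed.

Lemma infinite_int_unbounded D : infinite_set D ->
  (forall N, exists2 i, N <= i & D i) \/ (forall N, exists2 i, N <= - i & D i).
Proof.
move=> infD; apply: contrapT => /not_orP[/existsNP[N hN] /existsNP[M hM]].
apply: infD; apply: sub_finite_set (finite_seq (irange (- M) N)) => i Di /=.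
rewrite mem_irange; apply/andP; split; rewrite leNgt; apply/negP => h.
  by apply: hM; exists i => //; move: h; clear; lia.
by apply: hN; exists i => //; exact: ltW.
Qed.

Lemma interval_ray N : is_interval [set i : int | N <= i].
Proof. by move=> i j /= + _ k; lia. Qed.

Lemma interval_rayC N : is_interval (~` [set i : int | N <= i]).
Proof. by move=> i j /= _ + k; lia. Qed.

Lemma crossing_domain_oscillates x y D M : crossing_domain x y D ->
  (forall N, exists2 i, N <= i & D i) ->
  (exists2 j, M <= j & x j < y j) /\ (exists2 j, M <= j & y j < x j).
Proof.
move=> cD unbD; have [i0 _ Di0] := unbD 0.
pose N := Num.max M (i0 + 1).
have [MN i0N] : M <= N /\ i0 < N by rewrite /N; clear; lia.
have [i1 Ni1 Di1] := unbD N.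
have nord : ~ weakly_ordered_on [set i | N <= i] x y.
  apply: (crossing_domain_sign_change cD).
  - exact: interval_ray.
  - exact: interval_rayC.
  - by exists i1.
  - by exists i0; split => //=; move: i0N; clear; lia.
split; apply: contrapT => h; apply: nord; [right|left] => i /= Ni;
  rewrite leNgt; apply/negP => xyi; apply: h; exists i => //; exact: le_trans Ni.
Qed.

Definition crossings_grow_in x y D (r d : nat) : Prop :=
  exists k l : nat -> int,
    [/\ monotone_int k, monotone_int l,
        forall n, D (k n) /\ D (l n),
        forall n, `|k n.+1 - k n| <= d%:Z /\ `|l n - k n| <= r%:Z
      & forall n,
          [/\ y (k n) < x (k n), x (l n) < y (l n)
            & 2 ^+ n <= (x (k n) - y (k n)) * (y (l n) - x (l n))]].

Lemma crossings_grow_in_opp x y D r d :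
  crossings_grow_in (x \o -%R) (y \o -%R) (-%R @^-1` D) r d ->
  crossings_grow_in x y D r d.
Proof.
move=> [k [l [mk ml Dkl gap cross]]].
have mono (f : nat -> int) : monotone_int f -> monotone_int (-%R \o f).
  by move=> [h|h]; [right|left] => m n /h; rewrite /= lerN2.
exists (-%R \o k), (-%R \o l); split => //=; [exact: mono|exact: mono|].
move=> n; have [h1 h2] := gap n; move: h1 h2; clear; lia.
Qed.

Variables (r : nat) (lam kap : R).
Hypotheses (r0 : (0 < r)%N) (lam0 : 0 < lam) (lamkap : lam <= kap).

Definition crossing_gap : nat := doubling r lam kap + 2 * r.

(** If D were bounded above, x and y would be ordered far to the right, where
[unbounded_growing] provides crossing pairs.  So D contains a whole right ray. *)
Lemma unbounded_right_grow x y D : crossing_domain x y D -> D !=set0 ->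
  cut_ineq r lam kap (fun i => x i - y i) -> unbounded r (fun i => x i - y i) ->
  crossings_grow_in x y D r crossing_gap.
Proof.
move=> cD [i0 Di0] cut unb; have [itvD ordD _] := cD.
have unbD N : exists2 i, N <= i & D i.
  apply: contrapT => hN.
  have [k [l [_ hkl _ pair]]] := unbounded_growing lam0 lamkap r0 N cut unb.
  have /ordered_outsideP ord := ordD.
  have [||h|h] := ord [set i | N <= i]; first exact: interval_ray.
  - by move=> i /= Ni Di; apply: hN; exists i.
  - have [_ up _ _] := pair 0%N; have [/h + _] := hkl 0%N.
    by move: up; rewrite subr_gt0 ltNge => /negP up /up.
  - have [_ _ ul _] := pair 0%N; have [_ /h] := hkl 0%N.
    by move: ul; rewrite subr_lt0 ltNge => /negP ul /ul.
have [k [l [mono hkl gap pair]]] := unbounded_growing lam0 lamkap r0 i0 cut unb.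
have inD i : i0 <= i -> D i.
  by move=> i0i; have [j ij Dj] := unbD i; apply: itvD Di0 Dj _ _; rewrite i0i.
exists k, l; split.
- by left => m n /mono[].
- by left => m n /mono[].
- by move=> n; have [/inD ? /inD ?] := hkl n.
- by move=> n; split; [exact: gap|have [h _ _ _] := pair n; rewrite distrC].
- move=> n; have [_] := pair n; rewrite subr_gt0 subr_lt0 => xk xl h.
  by split => //; rewrite -[y _ - x _]opprB.
Qed.

(** Since [unbounded_left_or_right] does not tell on which side the crossings grow,
reflection is used both to exchange the sides of D and to reduce growth on the
left to growth on the right. *)
Lemma minimizers_grow (g : 'I_r -> R -> R -> R) x y D :
  (forall m, twist_pair lam kap (g m)) -> minimizer g x -> minimizer g y ->
  crossing_domain x y D -> infinite_set D ->
  crossings_grow_in x y D r crossing_gap.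
Proof.
move=> twist minx miny cD infD.
pose u i := x i - y i.
have cut : cut_ineq r lam kap u := minimizers_cut_ineq lam0 lamkap twist minx miny.
have D0 : D !=set0 by apply: infinite_setN0.
have D0' : -%R @^-1` D !=set0 by have [i Di] := D0; exists (- i); rewrite /= opprK.
have cD' := crossing_domain_opp cD.
have pair p q s : p < q -> q < s -> 0 < u p -> u q < 0 -> 0 < u s ->
    exists i k, [/\ `|i - k| <= r%:Z, 0 < u i & u k < 0].
  rewrite /u !subr_gt0 !subr_lt0 => pq qs up uq us.
  exact: (sign_change_crossing lam0 lamkap twist r0 minx miny pq qs).
have [|] : unbounded r u \/ unbounded r (u \o -%R).
- have [unbD|unbD] := infinite_int_unbounded infD.
    have osc M := crossing_domain_oscillates M cD unbD.
    have oscp M : exists2 j, M <= j & 0 < u j.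
      by have [_ [j ? ?]] := osc M; exists j; rewrite ?subr_gt0.
    have oscn M : exists2 j, M <= j & u j < 0.
      by have [[j ? ?] _] := osc M; exists j; rewrite ?subr_lt0.
    apply: (unbounded_left_or_right lam0 lamkap r0 cut _ oscn oscp).
    have [p _ up] := oscp 0; have [q pq uq] := oscn (p + 1).
    have [s qs us] := oscp (q + 1).
    by apply: pair up uq us; [move: pq|move: qs]; clear; lia.
  have unbD' N : exists2 i, N <= i & (-%R @^-1` D) i.
    by have [i Ni Di] := unbD N; exists (- i); rewrite //= opprK.
  have osc M := crossing_domain_oscillates M cD' unbD'.
  have oscp M : exists2 j, M <= j & 0 < (u \o -%R) j.
    by have [_ [j ? ?]] := osc M; exists j; rewrite //= subr_gt0.
  have oscn M : exists2 j, M <= j & (u \o -%R) j < 0.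
    by have [[j ? ?] _] := osc M; exists j; rewrite //= subr_lt0.
  suff : unbounded r (u \o -%R) \/ unbounded r ((u \o -%R) \o -%R).
    have -> : (u \o -%R) \o -%R = u by apply/funext => i /=; rewrite opprK.
    by case; [right|left].
  apply: (unbounded_left_or_right lam0 lamkap r0 (cut_ineq_refl cut) _ oscn oscp).
  have [p _ up] := oscp 0; have [q pq uq] := oscn (p + 1).
  have [s qs us] := oscp (q + 1).
  have [||i [k [ik ui uk]]] := pair _ _ _ _ _ us uq up.
  - by move: qs; clear; lia.
  - by move: pq; clear; lia.
  - by exists (- i), (- k); split; rewrite /= ?opprK//; move: ik; clear; lia.
- exact: unbounded_right_grow.
- move=> unb; apply: crossings_grow_in_opp; apply: unbounded_right_grow => //.
  exact: (cut_ineq_refl cut).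
Qed.

End CrossingDomain.

Theorem theoremB (R : realType) (r : nat) (K lambda : R)
    (hr : (1 <= r)%N) (hK : 0 < K) (hlambda : 0 < lambda) :
  exists d : nat,
    forall (S : 'rV[R]_r.+1 -> R) (x y : int -> R) (D : set int),
      local_energy K lambda S ->
      global_minimizer S x -> global_minimizer S y ->
      crossing_domain x y D -> infinite_set D ->
      exists k l : nat -> int,
        [/\ monotone_int k, monotone_int l,
            forall n, D (k n) /\ D (l n),
            forall n, `|k n.+1 - k n| <= d%:Z /\ `|l n - k n| <= r%:Z
          & forall n,
              [/\ y (k n) < x (k n), x (l n) < y (l n)
                & 2 ^+ n <= (x (k n) - y (k n)) * (y (l n) - x (l n))]].
Proof.
exists (crossing_gap r lambda (K / r%:R)) => S x y D hS minx miny cD infD.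
have [g [lamkap twist min_g]] := local_energy_pairs hr hS.
exact: (minimizers_grow hr hlambda lamkap twist (min_g x minx) (min_g y miny) cD infD).
Qed.
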